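(* Let $\circledast,\odot$ be proper multiplications on $\mathbb{Z}^d$. For every integer $r\geq 2$, the classes $\mathcal{IP}_r^*(\circledast)$ and $\mathcal{IP}_r^*(\odot)$ are equal if and only if $\circledast=\odot$ or $\circledast=\odot_{\mathrm{op}}$.
   Context: A proper multiplication on $\mathbb{Z}^d$ is a binary operation $\circledast:\mathbb{Z}^d\times\mathbb{Z}^d\to\mathbb{Z}^d$ that makes $(\mathbb{Z}^d,+)$ into an associative (not necessarily commutative or unital) ring without zero divisors; $\mathbb{Z}^d_{\neq 0}=\mathbb{Z}^d\setminus\{0\}$. The opposite operation is $x\odot_{\mathrm{op}}y=y\odot x$. For a semigroup $(S,\cdot)$ and $r\in\mathbb{N}$, a set $A\subseteq S$ is $\mathrm{IP}_r$ if there are $s_1,\dots,s_r\in S$ with $A\supseteq\{s_{i_1}\cdot s_{i_2}\cdots s_{i_k}: 1\le k\le r,\ i_1<\dots<i_k,\ \{i_1,\dots,i_k\}\subseteq\{1,\dots,r\}\}$ (products taken in increasing order of indices). $\mathcal{IP}_r^*(\circledast)$ is the class of subsets of $\mathbb{Z}^d_{\neq 0}$ having non-empty intersection with every $\mathrm{IP}_r$ subset of the semigroup $(\mathbb{Z}^d_{\neq 0},\circledast)$. *)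

(* Defs.v *)
From mathcomp Require Import all_boot all_order all_algebra.
From mathcomp Require Import boolp classical_sets.

Set Implicit Arguments.
Unset Strict Implicit.
Unset Printing Implicit Defensive.

Import GRing.Theory.

Local Open Scope classical_set_scope.
Local Open Scope ring_scope.

Section Semigroup.
Variable T : Type.

Definition opposite (op : T -> T -> T) : T -> T -> T := fun x y => op y x.

(* As [i :: l] is strictly increasing, it is an arbitrary non-empty subset
   i_1 < ... < i_k of the indices; [foldl] avoids the need for a unit. *)
Definition finite_products (op : T -> T -> T) (r : nat) (s : 'I_r -> T) :
    set T :=
  [set x | exists (i : 'I_r) (l : seq 'I_r),
    path (fun j k : 'I_r => (j < k)%N) i l /\
    x = foldl op (s i) [seq s j | j <- l]].

(* The semigroup is carried by the subset [S] of [T], closed under [op]. *)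
Definition IP (S : set T) (op : T -> T -> T) (r : nat) (A : set T) : Prop :=
  A `<=` S /\
  exists s : 'I_r -> T, (forall i, S (s i)) /\ finite_products op s `<=` A.

Definition IPstar (S : set T) (op : T -> T -> T) (r : nat) : set (set T) :=
  [set A | A `<=` S /\ forall B : set T, IP S op r B -> A `&` B !=set0].

End Semigroup.

Definition nonzero_vectors (d : nat) : set 'rV[int]_d := [set x | x <> 0].

Record proper_multiplication (d : nat)
    (mul : 'rV[int]_d -> 'rV[int]_d -> 'rV[int]_d) : Prop := {
  proper_mulA : associative mul;
  proper_mulDl : left_distributive mul +%R;
  proper_mulDr : right_distributive mul +%R;
  proper_mul_eq0 : forall x y, mul x y = 0 -> x = 0 \/ y = 0
}.

Definition IPstar_nonzero (d : nat)
    (mul : 'rV[int]_d -> 'rV[int]_d -> 'rV[int]_d) (r : nat) :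
    set (set 'rV[int]_d) :=
  IPstar (@nonzero_vectors d) mul r.

(* Main.v *)
Require Import Defs.
From mathcomp Require Import all_boot all_order all_algebra.
From mathcomp Require Import boolp classical_sets.

(**
  The class of IP_r sets is determined by its dual, so equal IP_r* classes mean
  equal IP_r classes. Given nonzero x, y, take s_1 = p_1 x, s_2 = p_2 y and
  s_i = p_i x for i > 2, with p_1, ..., p_r distinct primes so large that they
  divide none of the relevant products. The set of p_i dividing a product of
  the s_i then recovers the set I of its factors, and each such p_i divides it
  exactly once. If t_1, ..., t_r generate a set of products for the second
  multiplication inside the one of s for the first, the index sets of the t_j
  are therefore pairwise disjoint, hence singletons: t is a rearrangement of s.
  Comparing the product of s_1 and s_2 for both multiplications shows that the
  first product of x and y is the second product of x and y, or of y and x.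
  As a group is never the union of two proper subgroups, the same
  alternative holds for all x and y simultaneously.
*)

Set Implicit Arguments.
Unset Strict Implicit.
Unset Printing Implicit Defensive.

Import GRing.Theory Num.Theory.

Local Open Scope classical_set_scope.
Local Open Scope ring_scope.

(** * Order reversal and duality for IP_r sets *)

Lemma foldl_assoc (T : Type) (op : T -> T -> T) (opA : associative op) a b l :
  op a (foldl op b l) = foldl op (op a b) l.
Proof. by elim: l b => //= c l IHl b; rewrite IHl opA. Qed.

Lemma foldl_opposite (T U : Type) (op : T -> T -> T) (opA : associative op)
    (s : U -> T) i l :
  exists i' l', i' :: l' = rev (i :: l) /\
    foldl (opposite op) (s i) (map s l) = foldl op (s i') (map s l').
Proof.
elim/last_ind: l => [|l j [i' [l' [El Ef]]]]; first by exists i, [::].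
exists j, (i' :: l'); split; first by rewrite El -rcons_cons rev_rcons.
by rewrite map_rcons foldl_rcons Ef /= -foldl_assoc.
Qed.

(** Listing the generators backwards through [rev_ord] cancels the reversal of the factors, so every
    new product is one of the original products. *)
Lemma IP_opposite (T : Type) (S : set T) (op : T -> T -> T) r (A : set T) :
  associative op -> IP S op r A -> IP S (opposite op) r A.
Proof.
move=> opA [AS [s [sS sA]]]; split=> //.
exists (fun i => s (rev_ord i)); split=> // _ [i [l [il ->]]].
apply: sA.
have [i' [l' [El Ef]]] := foldl_opposite opA (s \o @rev_ord r) i l.
exists (rev_ord i'), (map (@rev_ord r) l'); split; last first.
  by rewrite -map_comp; exact: Ef.
have : sorted (fun j k : 'I_r => (k < j)%N) (i' :: l').
  by rewrite El rev_sorted.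
rewrite -[path _ _ _]/(sorted _ (map (@rev_ord r) (i' :: l'))) sorted_map.
apply: sub_sorted => j k /= kj.
by rewrite ltn_sub2l // (leq_ltn_trans kj).
Qed.

Lemma IP_superset (T : Type) (S : set T) (op : T -> T -> T) r (A B : set T) :
  A `<=` B -> B `<=` S -> IP S op r A -> IP S op r B.
Proof.
by move=> AB BS [_ [s [sS sA]]]; split=> //; exists s; split=> // x /sA/AB.
Qed.

(** If [A] were not IP_r for [op2], its complement in [S] would meet every IP_r set of [op2], since
    IP_r sets are stable under enlargement. The complement would then lie in both classes, yet it
    misses [A], which is IP_r for [op1]. *)
Lemma IPstar_eq_IP (T : Type) (S : set T) (op1 op2 : T -> T -> T) r A :
  IPstar S op1 r = IPstar S op2 r -> IP S op1 r A -> IP S op2 r A.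
Proof.
move=> E IPA; apply: contrapT => nIPA.
have : IPstar S op2 r (S `\` A).
  split=> [x []//|B IPB]; apply: contrapT => nSAB; apply: nIPA.
  have [BS _] := IPB; apply: IP_superset IPB; last by case: IPA.
  move=> x Bx; apply: contrapT => nAx; apply: nSAB; exists x.
  by split=> //; split=> //; apply: BS.
by rewrite -E => -[_ /(_ A IPA)] [x [[_ nAx] Ax]].
Qed.

(** * Groups covered by two subgroups *)

Lemma subgroup_cover (V : zmodType) (P Q : V -> Prop) :
  (forall x y, P x -> P y -> P (x - y)) ->
  (forall x y, Q x -> Q y -> Q (x - y)) ->
  (forall x, P x \/ Q x) -> (forall x, P x) \/ (forall x, Q x).
Proof.
move=> PB QB PQ; apply: contrapT => /not_orP[/existsNP[a Pa] /existsNP[b Qb]].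
have Pb : P b by case: (PQ b).
have Qa : Q a by case: (PQ a).
(* As [a] is outside [P] and [b] outside [Q], the sum can lie in neither. *)
case: (PQ (a + b)) => [Pab|Qab].
  by apply: Pa; rewrite -(addrK b a); apply: PB.
by apply: Qb; rewrite -(addrK a b) [b + a]addrC; apply: QB.
Qed.

(** * Large primes and products of distinct primes *)

Lemma exists_large_primes (M : nat) :
  exists q : nat -> nat, injective q /\ forall n, prime (q n) /\ (M < q n)%N.
Proof.
pose next m := s2val (prime_above m).
have next_gt m : (m < next m)%N by rewrite /next; case: prime_above.
have next_prime m : prime (next m) by rewrite /next; case: prime_above.
(* Iterating [next] gives a strictly increasing, hence injective, sequence; starting at [n.+1] keeps
   it above [M]. *)
pose q n := iter n.+1 next M.
have q_homo : {homo q : m n / (m < n)%N}.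
  by apply: homo_ltn => [|n]; [exact: ltn_trans | exact: next_gt].
exists q; split=> [m n qmn|n].
  by case: (ltngtP m n) => // /q_homo; rewrite qmn ltnn.
split; first exact: next_prime.
apply: (@leq_trans (q 0)); first exact: next_gt.
by elim: n => // n /leq_trans-> //; rewrite ltnW ?next_gt.
Qed.

Lemma dvdn_prod_injective_primes (I : eqType) (p : I -> nat) (i : I) (L : seq I) :
  injective p -> (forall i, prime (p i)) ->
  (p i %| \prod_(j <- L) p j)%N = (i \in L).
Proof.
move=> p_inj p_prime; elim: L => [|j L IHL].
  rewrite big_nil dvdn1 in_nil; apply/eqP => pi1.
  by have := p_prime i; rewrite pi1.
by rewrite big_cons Euclid_dvdM // IHL in_cons dvdn_prime2 // (inj_eq p_inj).
Qed.

(** A second factor [p i] would divide the product over [L] with [i] removed, where [i] no longer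
    occurs. *)
Lemma dvdn_sqr_prod_injective_primes (I : eqType) (p : I -> nat) (i : I) (L : seq I) :
  injective p -> (forall i, prime (p i)) -> uniq L ->
  ~~ (p i ^ 2 %| \prod_(j <- L) p j)%N.
Proof.
move=> p_inj p_prime uL; apply/negP => p2L.
have iL : i \in L.
  rewrite -(dvdn_prod_injective_primes i L p_inj p_prime).
  by apply: dvdn_trans p2L; rewrite expnS dvdn_mulr.
move: p2L; rewrite (perm_big _ (perm_to_rem iL)) big_cons expnS expn1.
rewrite dvdn_pmul2l ?prime_gt0 // dvdn_prod_injective_primes //.
by rewrite mem_rem_uniqF.
Qed.

(** * Divisibility of integer vectors *)

Section VectorDivisibility.
Variable d : nat.
Implicit Types (v : 'rV[int]_d) (n p : nat).

Definition vector_dvd n v := [forall j, (n %| `|v ord0 j|)%N].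

(** The sup norm, which bounds the primes that can divide a nonzero vector. *)
Definition vector_height v := (\max_j `|v ord0 j|)%N.

Lemma absz_mulrn (a : int) n : `|a *+ n|%N = (`|a| * n)%N.
Proof. by rewrite -mulr_natr abszM natz. Qed.

Lemma vector_dvd_height v p :
  v != 0 -> (vector_height v < p)%N -> ~~ vector_dvd p v.
Proof.
move=> v0 hp; apply: contra v0 => /forallP pv; apply/eqP/rowP => j; rewrite mxE.
apply/eqP; rewrite -absz_eq0; apply: contraTT (pv j); rewrite -lt0n => vj0.
apply/negP => /(dvdn_leq vj0); apply/negP; rewrite -ltnNge.
by apply: leq_ltn_trans hp; exact: (leq_bigmax j).
Qed.

Lemma vector_dvd_mulrn m n v : (m %| n)%N -> vector_dvd m (v *+ n).
Proof. by move=> mn; apply/forallP => j; rewrite mulmxnE absz_mulrn dvdn_mull. Qed.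

(** Some coordinate of [v] is prime to [p], so the whole power must divide [n]. Exponent 1 serves to
    detect the factors of a product, exponent 2 to exclude repetitions. *)
Lemma vector_dvd_gauss p e n v :
  prime p -> ~~ vector_dvd p v -> vector_dvd (p ^ e) (v *+ n) -> (p ^ e %| n)%N.
Proof.
move=> pp /forallPn[j pvj] /forallP/(_ j); rewrite mulmxnE absz_mulrn.
by rewrite Gauss_dvdr // coprimeXl // prime_coprime.
Qed.

Lemma mulrn_vector_inj n v1 v2 : (0 < n)%N -> v1 *+ n = v2 *+ n -> v1 = v2.
Proof.
move=> n0 E; apply/rowP => j; move/rowP/(_ j): E; rewrite !mulmxnE => /eqP.
by rewrite eqrMn2r -?lt0n // => /orP[|/eqP//]; rewrite -leqn0 leqNgt n0.
Qed.

End VectorDivisibility.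

(** * Integer multiples and nonvanishing of products *)

Section ProperMultiplication.
Variables (d : nat) (mul : 'rV[int]_d -> 'rV[int]_d -> 'rV[int]_d).
Hypothesis Hmul : proper_multiplication mul.

Lemma proper_mul0l y : mul 0 y = 0.
Proof. by apply: (addIr (mul 0 y)); rewrite -(proper_mulDl Hmul) !add0r. Qed.

Lemma proper_mul0r x : mul x 0 = 0.
Proof. by apply: (addIr (mul x 0)); rewrite -(proper_mulDr Hmul) !add0r. Qed.

Lemma proper_mulBl x y z : mul (x - y) z = mul x z - mul y z.
Proof. by apply: (addIr (mul y z)); rewrite -(proper_mulDl Hmul) !subrK. Qed.

Lemma proper_mulBr x y z : mul x (y - z) = mul x y - mul x z.
Proof. by apply: (addIr (mul x z)); rewrite -(proper_mulDr Hmul) !subrK. Qed.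

Lemma proper_mulMnl x y n : mul (x *+ n) y = mul x y *+ n.
Proof.
elim: n => [|n IHn]; first by rewrite !mulr0n proper_mul0l.
by rewrite !mulrS (proper_mulDl Hmul) IHn.
Qed.

Lemma proper_mulMnr x y n : mul x (y *+ n) = mul x y *+ n.
Proof.
elim: n => [|n IHn]; first by rewrite !mulr0n proper_mul0r.
by rewrite !mulrS (proper_mulDr Hmul) IHn.
Qed.

Lemma proper_mul_neq0 x y : x != 0 -> y != 0 -> mul x y != 0.
Proof.
move=> x0 y0; apply/eqP => /(proper_mul_eq0 Hmul)[] /eqP; exact/negP.
Qed.

Lemma foldl_proper_mul_neq0 (I : Type) (x : I -> 'rV[int]_d) i l :
  (forall i, x i != 0) -> foldl mul (x i) (map x l) != 0.
Proof.
move=> x0; elim/last_ind: l => //= l j IHl.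
by rewrite map_rcons foldl_rcons proper_mul_neq0.
Qed.

(** Biadditivity pulls out all scalars; the primes in the resulting coefficient record which indices
    were multiplied. *)
Lemma foldl_proper_mulMn (I : Type) (p : I -> nat) (x : I -> 'rV[int]_d) i l :
  foldl mul (x i *+ p i) [seq x j *+ p j | j <- l] =
  foldl mul (x i) (map x l) *+ \prod_(j <- i :: l) p j.
Proof.
elim/last_ind: l => [|l j IHl]; first by rewrite big_seq1.
rewrite !map_rcons !foldl_rcons IHl proper_mulMnl proper_mulMnr -mulrnA.
by rewrite -rcons_cons -cats1 big_cat big_seq1 mulnC.
Qed.

End ProperMultiplication.

(** * Products of prime multiples under two multiplications *)

Section Comparison.
Variables (d : nat) (mul1 mul2 : 'rV[int]_d -> 'rV[int]_d -> 'rV[int]_d).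
Hypotheses (Hmul1 : proper_multiplication mul1) (Hmul2 : proper_multiplication mul2).
Variable r : nat.

Let ordlt : rel 'I_r := fun j k => (j < k)%N.

Let ordlt_trans : transitive ordlt.
Proof. by move=> b a c; exact: ltn_trans. Qed.

Let ordlt_irr : irreflexive ordlt.
Proof. by move=> a; exact: ltnn. Qed.

Lemma ordlt_path_uniq (i : 'I_r) l : path ordlt i l -> uniq (i :: l).
Proof. exact: (sorted_uniq ordlt_trans ordlt_irr (s := i :: l)). Qed.

Section Rearrangement.
Variables (p : 'I_r -> nat) (x : 'I_r -> 'rV[int]_d).
Hypotheses (p_inj : injective p) (p_prime : forall i, prime (p i)).
(** Since no prime divides the unscaled products, divisibility by [p k] only sees the scalar
    coefficients. *)
Hypothesis p_ndvd1 : forall k i l, path ordlt i l ->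
  ~~ vector_dvd (p k) (foldl mul1 (x i) (map x l)).
Hypothesis p_ndvd2 : forall k i j, ~~ vector_dvd (p k) (mul2 (x i) (x j)).

Lemma dvd_prod_index k i l v n : path ordlt i l ->
  v *+ n = foldl mul1 (x i) (map x l) *+ \prod_(j <- i :: l) p j ->
  (p k %| n)%N -> k \in i :: l.
Proof.
move=> il E kn; rewrite -(dvdn_prod_injective_primes k (i :: l) p_inj p_prime).
rewrite -(expn1 (p k)); apply: vector_dvd_gauss (p_ndvd1 k il) _ => //.
by rewrite expn1 -E vector_dvd_mulrn.
Qed.

(** A shared index would put the square of [p k] into the left side, while the increasing list on
    the right has each prime at most once. *)
Lemma factors_disjoint i1 l1 i2 l2 i3 l3 k :
  path ordlt i3 l3 ->
  mul2 (foldl mul1 (x i1) (map x l1) *+ \prod_(j <- i1 :: l1) p j)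
       (foldl mul1 (x i2) (map x l2) *+ \prod_(j <- i2 :: l2) p j) =
  foldl mul1 (x i3) (map x l3) *+ \prod_(j <- i3 :: l3) p j ->
  k \in i1 :: l1 -> k \in i2 :: l2 -> False.
Proof.
move=> il3 E k1 k2.
apply/negP: (dvdn_sqr_prod_injective_primes k p_inj p_prime (ordlt_path_uniq il3)).
apply/negPn; apply: vector_dvd_gauss (p_ndvd1 k il3) _ => //.
rewrite -E (proper_mulMnl Hmul2) (proper_mulMnr Hmul2) -mulrnA.
by apply: vector_dvd_mulrn; rewrite expnS expn1 dvdn_mul ?dvdn_prod_injective_primes.
Qed.

(** Comparing prime divisors, [i :: l] has exactly the members [a] and [b], and being increasing it
    is determined by them. Cancelling the two primes leaves the claim. *)
Lemma two_factor_product (a b i : 'I_r) l : (a < b)%N -> path ordlt i l ->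
  forall u v, (u = a /\ v = b) \/ (u = b /\ v = a) ->
  mul2 (x u *+ p u) (x v *+ p v) =
    foldl mul1 (x i) (map x l) *+ \prod_(j <- i :: l) p j ->
  mul2 (x u) (x v) = mul1 (x a) (x b).
Proof.
move=> ab il u v uvab.
rewrite (proper_mulMnl Hmul2) (proper_mulMnr Hmul2) -mulrnA => E.
have il_ab : i :: l = [:: a; b].
  apply: (irr_sorted_eq ordlt_trans ordlt_irr) => //=; first by rewrite /ordlt ab.
  move=> k; rewrite [in RHS]inE [in RHS]mem_seq1.
  apply/idP/idP => [kil|kab]; last first.
    apply: (dvd_prod_index il E).
    by case: uvab kab => -[-> ->] /orP[]/eqP->;
      rewrite Euclid_dvdM // dvdnn ?orbT.
  have : (p k ^ 1 %| p v * p u)%N.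
    apply: vector_dvd_gauss (p_ndvd2 k u v) _ => //.
    by rewrite E vector_dvd_mulrn // expn1 dvdn_prod_injective_primes.
  rewrite expn1 Euclid_dvdM // !dvdn_prime2 // !(inj_eq p_inj).
  by case: uvab => -[-> ->] /orP[] ->; rewrite ?orbT.
case: il_ab E => -> -> /=; rewrite big_cons big_seq1 => E.
apply: (@mulrn_vector_inj d (p v * p u)); first by rewrite muln_gt0 !prime_gt0.
by rewrite E; case: uvab => -[-> ->] //; rewrite mulnC.
Qed.

Lemma IP_rearrangement (a b : 'I_r) : (a < b)%N ->
  IP (@nonzero_vectors d) mul2 r
     (finite_products mul1 (fun i => x i *+ p i)) ->
  mul1 (x a) (x b) = mul2 (x a) (x b) \/ mul1 (x a) (x b) = mul2 (x b) (x a).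
Proof.
move=> ab [_ [t [_ tA]]].
have FP z : finite_products mul1 (fun i => x i *+ p i) z ->
    exists i l, path ordlt i l /\
      z = foldl mul1 (x i) (map x l) *+ \prod_(j <- i :: l) p j.
  by move=> [i [l [il ->]]]; exists i, l; rewrite (foldl_proper_mulMn Hmul1).
(* [h j] and [l j] become the head and tail of an index list expressing [t j]. *)
have /choice[h tP] : forall j, exists i, exists l, path ordlt i l /\
    t j = foldl mul1 (x i) (map x l) *+ \prod_(j <- i :: l) p j.
  by move=> j; apply/FP/tA; exists j, [::].
have {tP}/choice[l tP] := tP.
have tM (j k : 'I_r) : (j < k)%N -> exists i l, path ordlt i l /\
    mul2 (t j) (t k) = foldl mul1 (x i) (map x l) *+ \prod_(j <- i :: l) p j.
  by move=> jk; apply/FP/tA; exists j, [:: k]; rewrite /= jk.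
(* For distinct [j] and [k], the product of [t j] and [t k] in increasing order lies in the given
   set, which rules out a shared index. *)
have disj j k c : c \in h j :: l j -> c \in h k :: l k -> j = k.
  move=> cj ck; apply/val_inj; case: (ltngtP j k) => // /tM[i [l' [il' E]]].
    case: (@factors_disjoint (h j) (l j) (h k) (l k) i l' c) => //.
    by rewrite -!(proj2 (tP _)).
  case: (@factors_disjoint (h k) (l k) (h j) (l j) i l' c) => //.
  by rewrite -!(proj2 (tP _)).
have h_inj : injective h.
  by move=> j k hjk; apply: (disj j k (h j)); rewrite ?hjk mem_head.
(* An injective self-map of a finite set is onto, so the heads exhaust all indices. *)
have h_surj c : exists j, h j = c.
  by have [g _ gK] := injF_bij h_inj; exists (g c).
(* An index in a tail is also the head of some list, by disjointness of the same list, which has no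
   repetition. *)
have l_nil j : l j = [::].
  have [il _] := tP j; case E : (l j) il => [//|c s] il.
  have [k hk] := h_surj c.
  have jk : j = k by apply: (disj j k c); rewrite ?E -?hk !inE eqxx ?orbT.
  by have := ordlt_path_uniq il; rewrite jk hk /= inE eqxx.
have tE j : t j = x (h j) *+ p (h j).
  by have [_ ->] := tP j; rewrite l_nil big_seq1.
have [ja hja] := h_surj a; have [jb hjb] := h_surj b.
have jab : ja != jb.
  by apply: contraTneq ab => jab; rewrite -hja -hjb jab ltnn.
(* The positions in [t] of the generators built on [a] and [b] decide the order of the factors under
   [mul2]. *)
case: (ltngtP ja jb) => [|| /val_inj/eqP]; last by rewrite (negPf jab).
  move=> /tM[i [s [pis]]]; rewrite !tE hja hjb => E; left.
  by rewrite (two_factor_product ab pis _ E) //; left.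
move=> /tM[i [s [pis]]]; rewrite !tE hja hjb => E; right.
by rewrite (two_factor_product ab pis _ E) //; right.
Qed.

End Rearrangement.

Lemma mul_eq_or_opposite_pointwise (Hr : (2 <= r)%N) :
  IPstar_nonzero mul1 r = IPstar_nonzero mul2 r ->
  forall u v, mul1 u v = mul2 u v \/ mul1 u v = mul2 v u.
Proof.
move=> E u v.
have [->|u0] := eqVneq u 0.
  by left; rewrite (proper_mul0l Hmul1) (proper_mul0l Hmul2).
have [->|v0] := eqVneq v 0.
  by left; rewrite (proper_mul0r Hmul1) (proper_mul0r Hmul2).
(* The indices 0 and 1 exist because [r] is at least 2; they carry [u] and [v], and all other
   positions repeat [u]. *)
pose a : 'I_r := Ordinal (ltnW Hr); pose b : 'I_r := Ordinal Hr.
pose x (i : 'I_r) := if i == b then v else u.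
have x0 i : x i != 0 by rewrite /x; case: ifP.
(* Bounded sequences form a finite type containing every increasing tail, so the maximum makes
   sense. *)
pose M1 := (\max_(i : 'I_r) \max_(l : r.-bseq 'I_r)
  vector_height (foldl mul1 (x i) (map x l)))%N.
pose M2 := (\max_(i : 'I_r) \max_(j : 'I_r) vector_height (mul2 (x i) (x j)))%N.
have [q [q_inj qP]] := exists_large_primes (maxn M1 M2).
pose p (i : 'I_r) := q i.
have p_prime i : prime (p i) by case: (qP i).
have p_inj : injective p by move=> i j /q_inj/val_inj.
have p_ndvd1 k i l : path ordlt i l ->
    ~~ vector_dvd (p k) (foldl mul1 (x i) (map x l)).
  move=> il; apply: vector_dvd_height; first exact: foldl_proper_mul_neq0.
  have sl : (size l <= r)%N.
    have := card_uniqP (ordlt_path_uniq il).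
    by move=> /= c; rewrite ltnW // -c -[leqRHS]card_ord max_card.
  have [_] := qP k; apply: leq_ltn_trans; rewrite leq_max; apply/orP; left.
  apply: (leq_trans _ (leq_bigmax i)).
  exact: (leq_bigmax (Bseq sl)).
have p_ndvd2 k i j : ~~ vector_dvd (p k) (mul2 (x i) (x j)).
  apply: vector_dvd_height; first exact: proper_mul_neq0.
  have [_] := qP k; apply: leq_ltn_trans; rewrite leq_max; apply/orP; right.
  apply: (leq_trans _ (leq_bigmax i)).
  exact: (leq_bigmax j).
have xpn0 i : x i *+ p i != 0.
  apply: contra_neq (x0 i) => xp; apply: (@mulrn_vector_inj d (p i)).
    exact: prime_gt0.
  by rewrite xp mul0rn.
have IP1 : IP (@nonzero_vectors d) mul1 r
    (finite_products mul1 (fun i => x i *+ p i)).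
  split=> [_ [i [l [_ ->]]]|].
    exact/eqP/(foldl_proper_mul_neq0 Hmul1 _ _ xpn0).
  by exists (fun i => x i *+ p i); split=> // i; exact/eqP.
have := IP_rearrangement p_inj p_prime p_ndvd1 p_ndvd2 (a := a) (b := b) isT
  (IPstar_eq_IP E IP1).
by rewrite /x eqxx.
Qed.

End Comparison.

Lemma mul_eq_or_opposite (d : nat) (mul1 mul2 : 'rV[int]_d -> 'rV[int]_d -> 'rV[int]_d) :
  proper_multiplication mul1 -> proper_multiplication mul2 ->
  (forall u v, mul1 u v = mul2 u v \/ mul1 u v = mul2 v u) ->
  mul1 = mul2 \/ mul1 = opposite mul2.
Proof.
move=> Hmul1 Hmul2 H.
(* The covering lemma is used twice: for fixed [u] on the vectors [v], which makes one alternative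
   hold for all [v], and then on the vectors [u]. *)
have [||u|H'|H'] := @subgroup_cover _ (fun u => forall v, mul1 u v = mul2 u v)
  (fun u => forall v, mul1 u v = mul2 v u).
- by move=> x y Hx Hy v; rewrite (proper_mulBl Hmul1) (proper_mulBl Hmul2) Hx Hy.
- by move=> x y Hx Hy v; rewrite (proper_mulBl Hmul1) (proper_mulBr Hmul2) Hx Hy.
- apply: subgroup_cover => // x y Hx Hy.
    by rewrite (proper_mulBr Hmul1) (proper_mulBr Hmul2) Hx Hy.
  by rewrite (proper_mulBr Hmul1) (proper_mulBl Hmul2) Hx Hy.
- by left; apply/funext => u; apply/funext => v.
- by right; apply/funext => u; apply/funext => v; rewrite H'.
Qed.

(** Taking opposites is an involution, so the transfer of IP_r sets gives both inclusions. *)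
Lemma IPstar_opposite (T : Type) (S : set T) (op : T -> T -> T) r :
  associative op -> IPstar S (opposite op) r = IPstar S op r.
Proof.
move=> opA.
have opA' : associative (opposite op) by move=> x y z; rewrite /opposite opA.
apply/seteqP; split=> A [AS AB]; split=> // B IPB; apply: AB.
  exact: IP_opposite.
exact: (IP_opposite opA' IPB).
Qed.

Local Close Scope ring_scope.
Local Close Scope classical_set_scope.

Theorem theoremB (d : nat)
    (mul1 mul2 : 'rV[int]_d -> 'rV[int]_d -> 'rV[int]_d)
    (Hmul1 : proper_multiplication mul1) (Hmul2 : proper_multiplication mul2)
    (r : nat) (Hr : 2 <= r) :
  IPstar_nonzero mul1 r = IPstar_nonzero mul2 r <->
  mul1 = mul2 \/ mul1 = opposite mul2.
Proof.
split=> [E|[->//|->]].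
  exact: mul_eq_or_opposite Hmul1 Hmul2 (mul_eq_or_opposite_pointwise Hmul1 Hmul2 Hr E).
exact: IPstar_opposite (proper_mulA Hmul2).
Qed.
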